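(* Let $N=(B,E,F)$ be a locally finite, K-dense causal net, let $L(N)$ be its lattice of closed sets, and let $\lambda$ be a line of $N$. Define $\delta_\lambda: L(N)\to\{0,1\}$ by $\delta_\lambda(A)=1$ if $A\cap\lambda\neq\emptyset$, and $\delta_\lambda(A)=0$ otherwise. Then $\delta_\lambda$ is a two-valued state of $L(N)$.
   Context: A net is a triple $N=(B,E,F)$ where $B$ (conditions) and $E$ (events) are countable disjoint sets, $F\subseteq (B\times E)\cup(E\times B)$, and $\mathrm{dom}(F)\cup\mathrm{ran}(F)=B\cup E$. For $x\in B\cup E$ put ${}^\bullet x=\{y : (y,x)\in F\}$ and $x^\bullet=\{y : (x,y)\in F\}$. Let $F^+$ be the transitive closure of $F$ and $F^*$ its reflexive-transitive closure. $N$ is a causal net if every $b\in B$ satisfies $|{}^\bullet b|\le 1$ and $|b^\bullet|\le 1$, and for all $x,y\in B\cup E$, $(x,y)\in F^+$ implies $(y,x)\notin F^+$. Put $X=B\cup E$ and $\sqsubseteq\,=F^*$; then $(X,\sqsubseteq)$ is a partially ordered set. $N$ is locally finite if every interval $[x,y]=\{z : x\sqsubseteq z\sqsubseteq y\}$ is finite and, for all $x\in X$, ${}^\bullet x$ and $x^\bullet$ are finite. Define $\mathbf{li}=\,\sqsubseteq\cup\sqsubseteq^{-1}$ (comparability) and $\mathbf{co}=(X\times X)\setminus\mathbf{li}$ (concurrency). A line is a maximal set of pairwise $\mathbf{li}$-related elements (maximal chain); a cut is a maximal set of pairwise $\mathbf{co}\cup\mathrm{id}_X$-related elements (maximal antichain).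 $N$ is K-dense if every cut and every line of $(X,\sqsubseteq)$ have non-empty intersection. For $A\subseteq X$ let $A'=\{x\in X : \forall y\in A,\ x\ \mathbf{co}\ y\}$. $A$ is closed if $A=A''$, and $L(N)$ is the family of closed subsets of $X$. Ordered by inclusion, with orthocomplementation $A\mapsto A'$, minimum $\emptyset$ and maximum $X$, $L(N)$ is a complete orthocomplemented (in fact orthomodular) lattice, in which the meet is intersection and the join of a family $(A_i)$ is $(\bigcup_i A_i)''$. Closed sets $A,C$ are orthogonal if $A\subseteq C'$. A two-valued state on $L(N)$ is a map $s:L(N)\to\{0,1\}$ such that, for any sequence $(A_i)_{i\in I}$ of mutually orthogonal elements of $L(N)$ ($A_i\subseteq A_j'$ for $i\ne j$), one has $s(X)=1$ and $s\big(\bigvee_{i\in I}A_i\big)=\sum_{i\in I}s(A_i)$. *)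

(* Defs.v *)
From HB Require Import structures.
From Stdlib Require Import Relation_Operators.
From mathcomp Require Import all_boot all_order all_algebra.
From mathcomp Require Import boolp classical_sets functions cardinality reals.
From mathcomp Require Import ereal esum.

Set Implicit Arguments.
Unset Strict Implicit.
Unset Printing Implicit Defensive.

Local Open Scope card_scope.
Local Open Scope classical_set_scope.

(* The carrier [node] is exactly X = B `|` E, so every subset of X is a
   [set node] and set complements, maximality, etc. are relative to X. *)
Record net := Net {
  node : Type;
  cond : set node;
  event : set node;
  flow : set (node * node);
  net_cover : cond `|` event = setT;
  net_disjoint : cond `&` event = set0;
  countable_cond : countable cond;
  countable_event : countable event;
  flow_bipartite : flow `<=` (cond `*` event) `|` (event `*` cond);
  flow_full : flow.`1 `|` flow.`2 = cond `|` event
}.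

Section Net.
Variable N : net.
Implicit Types (x y z : node N) (A : set (node N)).

Definition preset x : set (node N) := [set y | flow (y, x)].
Definition postset x : set (node N) := [set y | flow (x, y)].

Definition flow_plus x y : Prop := clos_trans _ (fun u v => flow (u, v)) x y.
Definition flow_star x y : Prop :=
  clos_refl_trans _ (fun u v => flow (u, v)) x y.

Definition causal_net : Prop :=
  (forall b, cond b -> preset b #<= `I_1 /\ postset b #<= `I_1) /\
  (forall x y, flow_plus x y -> ~ flow_plus y x).

Definition order_interval x y : set (node N) :=
  [set z | flow_star x z /\ flow_star z y].

Definition locally_finite : Prop :=
  (forall x y, finite_set (order_interval x y)) /\
  (forall x, finite_set (preset x) /\ finite_set (postset x)).

Definition li x y : Prop := flow_star x y \/ flow_star y x.
Definition co x y : Prop := ~ li x y.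

Definition pairwise_related (r : node N -> node N -> Prop) A : Prop :=
  forall x y, A x -> A y -> r x y.

Definition maximal_related (r : node N -> node N -> Prop) A : Prop :=
  pairwise_related r A /\
  forall C, pairwise_related r C -> A `<=` C -> C = A.

Definition is_line : set (node N) -> Prop := maximal_related li.
Definition is_cut : set (node N) -> Prop :=
  maximal_related (fun x y => co x y \/ x = y).

Definition K_dense : Prop :=
  forall c l, is_cut c -> is_line l -> c `&` l !=set0.

Definition perp A : set (node N) := [set x | forall y, A y -> co x y].

Definition closed_set A : Prop := A = perp (perp A).

Lemma li_refl x : li x x.
Proof. by left; exact: rt_refl. Qed.

Lemma co_sym x y : co x y -> co y x.
Proof. by move=> nxy [xy|yx]; apply: nxy; [right|left]. Qed.

Lemma perp_anti A C : A `<=` C -> perp C `<=` perp A.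
Proof. by move=> AC x Cx y /AC/Cx. Qed.

Lemma sub_perp2 A : A `<=` perp (perp A).
Proof. by move=> x Ax y /(_ _ Ax)/co_sym. Qed.

Lemma closed_perp A : closed_set (perp A).
Proof.
rewrite /closed_set; apply/seteqP; split; first exact: sub_perp2.
by apply: perp_anti; exact: sub_perp2.
Qed.

Lemma closed_setT : closed_set setT.
Proof.
by apply/seteqP; split=> // x _ y /(_ y I) /(_ (li_refl y)).
Qed.

End Net.

Record closed_lattice (N : net) := Closed {
  closed_val :> set (node N);
  closed_valP : closed_set closed_val
}.

Notation "''L' ( N )" := (closed_lattice N)
  (at level 0, N at level 100, format "''L' ( N )").

Section ClosedLattice.
Variable N : net.
Implicit Types A C : 'L(N).

Definition ltop : 'L(N) := Closed (@closed_setT N).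

Definition lcompl A : 'L(N) := Closed (closed_perp (A : set (node N))).

Definition ljoin (T : Type) (I : set T) (A : T -> 'L(N)) : 'L(N) :=
  Closed (closed_perp (perp (\bigcup_(i in I) (A i : set (node N))))).

Lemma ljoin_ub (T : Type) (I : set T) (A : T -> 'L(N)) i :
  I i -> A i `<=` ljoin I A.
Proof. by move=> Ii x Ax; apply: sub_perp2; exists i. Qed.

Lemma ljoin_lub (T : Type) (I : set T) (A : T -> 'L(N)) C :
  (forall i, I i -> A i `<=` C) -> ljoin I A `<=` C.
Proof.
move=> AC; rewrite (closed_valP C); do 2 apply: perp_anti.
by move=> x [i Ii Ax]; exact: AC Ax.
Qed.

Definition orthogonal A C : Prop := A `<=` lcompl C.

(* A sequence is a family indexed by an arbitrary [I : set nat], hence finite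
   (possibly empty) or infinite; [\esum] takes its value, possibly +oo, in the
   extended reals, so that finiteness of the sum is part of the condition. *)
Definition two_valued_state (R : realType) (s : 'L(N) -> bool) : Prop :=
  s ltop = true /\
  forall (I : set nat) (A : nat -> 'L(N)),
    (forall i j, I i -> I j -> i <> j -> orthogonal (A i) (A j)) ->
    ((s (ljoin I A))%:R%:E = \esum_(i in I) (s (A i))%:R%:E :> \bar R)%R.

Definition line_state (l : set (node N)) (A : 'L(N)) : bool :=
  `[< A `&` l !=set0 >].

End ClosedLattice.

(* Main.v *)
From Stdlib Require Import Relation_Operators Operators_Properties.
Require Import Defs.
From mathcomp Require Import all_boot all_order all_algebra.
From mathcomp Require Import boolp classical_sets functions cardinality reals.
From mathcomp Require Import ereal esum.

(** The heart of the matter is that a maximal antichain [c] of a closed set [A]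
    satisfies [c' = A'].  If [x] were in [c'] but not in [A'], a path between
    [x] and some element of [A] comparable to it would, after leaving the
    elements bounded by [c], have to visit an element concurrent with both [c]
    and [A']: otherwise some arrow [u -> v] would have [u] branching forward
    and [v] branching backward, so both would be events.  That element lies in
    [A'' = A] and contradicts the maximality of [c].

    Given an orthogonal family [A_i] of union [U], maximal antichains [c_i] of
    the [A_i] and [d] of [U'] therefore form a cut together.  By K-density a
    line meets this cut; if it meets [U''] it cannot meet [d], hence it meets
    some [A_i], which is unique because distinct [A_i] are concurrent. *)

Set Implicit Arguments.
Unset Strict Implicit.
Unset Printing Implicit Defensive.

Local Open Scope card_scope.
Local Open Scope classical_set_scope.

Lemma card_le_I1_eq (T : Type) (A : set T) (x y : T) :
  A #<= `I_1 -> A x -> A y -> x = y.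
Proof.
move=> /pcard_leP[f] Ax Ay.
apply: (@inj _ _ _ f); rewrite ?inE//.
have := @funS _ _ _ _ f x Ax; have := @funS _ _ _ _ f y Ay.
by rewrite /= !ltnS !leqn0 => /eqP -> /eqP ->.
Qed.

Section Net.
Variable N : net.
Implicit Types (x y z u v p q s t : node N) (A c l : set (node N)).

Lemma star_trans x y z : flow_star x y -> flow_star y z -> flow_star x z.
Proof. exact: rt_trans. Qed.

(** Induction along the path, stopping at the first arrow that leaves [P]. *)
Lemma star_exit (P : set (node N)) s t : flow_star s t -> P s -> ~ P t ->
  exists u v, [/\ flow_star s u, flow (u, v), flow_star v t, P u & ~ P v].
Proof.
move=> st; have := clos_rt_rt1n _ _ _ _ st.
elim=> {s t st} [x Px /(_ Px)//|x y z xy yz' IH Px Pz].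
have yz : flow_star y z := clos_rt1n_rt _ _ _ _ yz'.
have [Py|Py] := pselect (P y); last by exists x, y; split=> //; exact: rt_refl.
have [u [v [yu uv vz Pu Pv]]] := IH Py Pz.
by exists u, v; split=> //; apply: star_trans yu; exact: rt_step.
Qed.

Lemma star_first x y : flow_star x y -> x <> y ->
  exists2 z, flow (x, z) & flow_star z y.
Proof.
move=> xy; have := clos_rt_rt1n _ _ _ _ xy.
by case=> [//|z w xz zw _]; exists z => //; exact: clos_rt1n_rt.
Qed.

Lemma star_last x y : flow_star x y -> x <> y ->
  exists2 z, flow (z, y) & flow_star x z.
Proof.
move=> xy; have := clos_rt_rtn1 _ _ _ _ xy.
by case=> [//|z w zy xz _]; exists z => //; exact: clos_rtn1_rt.
Qed.

(** One end of an arrow is a condition. If it is [u], its only successor is [v], so the path to [p]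
    runs through [v]; if it is [v], its only predecessor is [u], so the path from [q] runs through
    [u]. *)
Lemma crossing_flow_absurd (hN : causal_net N) u v p q :
  flow (u, v) -> flow_star u p -> flow_star q v ->
  ~ flow_star v p -> ~ flow_star q u -> u <> p -> q <> v -> False.
Proof.
move=> uv up qv nvp nqu /(star_first up)[v' uv' v'p] /(star_last qv)[u' u'v qu'].
have [[cu _]|[_ cv]] := flow_bipartite uv.
  have vv' : v = v' := card_le_I1_eq (hN.1 u cu).2 uv uv'.
  by apply: nvp; rewrite vv'.
have uu' : u = u' := card_le_I1_eq (hN.1 v cv).1 uv u'v.
by apply: nqu; rewrite uu'.
Qed.

(* For singletons [D] and [U] this is the N-density of the order. *)
Lemma N_dense_sets (hN : causal_net N) (D U : set (node N)) s t :
  flow_star s t ->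
  (exists2 p, D p & flow_star s p) -> (exists2 q, U q & flow_star q t) ->
  (forall p q, D p -> U q -> co p q) ->
  (forall p, D p -> ~ flow_star p t) -> (forall q, U q -> ~ flow_star s q) ->
  exists2 z, flow_star s z /\ flow_star z t & perp (D `|` U) z.
Proof.
move=> st [p Dp sp] [q Uq qt] DU nDt nsU.
apply: contrapT => noz.
(* Between [s] and [t], a node cannot lie above [D] or below [U], so these are the only ways left to
   be comparable to [D] or [U]. *)
have bounded z : flow_star s z -> flow_star z t ->
    (exists2 p, D p & flow_star z p) \/ (exists2 q, U q & flow_star q z).
  move=> sz zt; apply: contrapT => /not_orP[nD nU].
  apply: noz; exists z => // w [Dw|Uw] [zw|wz].
  - by apply: nD; exists w.
  - exact: nDt Dw (star_trans wz zt).
  - exact: nsU Uw (star_trans sz zw).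
  - by apply: nU; exists w.
have nPt : ~ exists2 p, D p & flow_star t p.
  by move=> [p' Dp' tp']; apply: (DU p' q Dp' Uq); right; exact: star_trans tp'.
(* The arrow on which the path leaves the down-set of [D]: its head [v] must then lie above [U]. *)
have [u [v [su uv vt [p' Dp' up'] nPv]]] :=
  @star_exit [set z | exists2 p, D p & flow_star z p] _ _ st
    (ex_intro2 _ _ p Dp sp) nPt.
have sv : flow_star s v by apply: star_trans su _; exact: rt_step.
have [//|[q' Uq' q'v]] := bounded v sv vt.
apply: (crossing_flow_absurd hN uv up' q'v).
- by move=> vp'; apply: nPv; exists p'.
- by move=> q'u; apply: (DU p' q') => //; right; exact: star_trans up'.
- move=> up; apply: (nDt p' Dp'); rewrite -up.
  by apply: star_trans vt; exact: rt_step.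
- by move=> qv; apply: (nsU q' Uq'); rewrite qv.
Qed.

Lemma perp_maximal (hN : causal_net N) A c : closed_set A -> c `<=` A ->
  (forall a, A a -> exists2 e, c e & li a e) -> perp c = perp A.
Proof.
move=> clA cA maxc; apply/seteqP; split; last exact: perp_anti.
have absurd z : perp (c `|` perp A) z -> False.
  move=> cAz.
  have /maxc[e ce /cAz] : A z by rewrite clA => y yA; apply: cAz; right.
  by apply; left.
move=> x xc a Aa xa.
have [e ce ae] := maxc a Aa.
(* Otherwise [x] would lie in [A''], which is [A], and so be comparable to an element of [c]. *)
have [y Ay xy] : exists2 y, perp A y & li x y.
  apply: contrapT => nxy.
  have Ax : A x by rewrite clA => y Ay xy; apply: nxy; exists y.
  by have [e' ce' /(xc _ ce')] := maxc x Ax.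
have yperp p q : c p -> perp A q -> co p q.
  by move=> cp Aq; apply/co_sym/Aq/cA.
have aperp q : perp A q -> co a q by move=> Aq; apply/co_sym/Aq.
(* The cases are dual. Since [x] is concurrent with [c] and [a] with [perp A], transitivity fixes
   the direction in which [y] is comparable to [x] and [e] to [a]. *)
case: xa => [xa|ax].
- have [||||| z _] := @N_dense_sets hN (perp A) c x a xa.
  + exists y => //; case: xy => // yx; case: (aperp y Ay); right.
    exact: star_trans xa.
  + exists e => //; case: ae => // ae; case: (xc e ce); left.
    exact: star_trans ae.
  + by move=> p q Ap cq; apply/co_sym/yperp.
  + by move=> p Ap pa; apply: (aperp p Ap); right.
  + by move=> q cq xq; apply: (xc q cq); left.
  + by rewrite setUC; exact: absurd.
- have [||||| z _] := @N_dense_sets hN c (perp A) a x ax.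
  + exists e => //; case: ae => // ea; case: (xc e ce); right.
    exact: star_trans ax.
  + exists y => //; case: xy => // xy; case: (aperp y Ay); left.
    exact: star_trans xy.
  + exact: yperp.
  + by move=> p cp px; apply: (xc p cp); right.
  + by move=> q Aq aq; apply: (aperp q Aq); left.
  + exact: absurd.
Qed.

Let antichain := pairwise_related (fun x y : node N => co x y \/ x = y).

(** By Zorn's lemma: an element of [A] concurrent with all of [c] could be added to [c]. *)
Lemma maximal_antichain A : exists c,
  [/\ c `<=` A, antichain c & forall a, A a -> exists2 e, c e & li a e].
Proof.
have [F F_chain F_sub|c [[cA anc] maxc]] :=
    @Zorn_bigcup _ [set c | c `<=` A /\ antichain c].
  split=> [x [c Fc cx]|x y [c Fc cx] [d Fd dy]]; first exact: (F_chain c Fc).1.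
  have [cd|dc] := F_sub c d Fc Fd.
    by apply: (F_chain d Fd).2 => //; exact: cd.
  by apply: (F_chain c Fc).2 => //; exact: dc.
exists c; split=> // a Aa; apply: contrapT => na.
have aco e : c e -> co a e by move=> ce ae; apply: na; exists e.
apply: (maxc (c `|` [set a])).
  split; first by left.
  move=> /(_ a (or_intror erefl)) ca.
  by apply: (aco a ca); exact: li_refl.
split; first by move=> x [/cA//|->].
move=> x y [cx|->] [cy|->]; last by right.
- exact: anc.
- by left; apply/co_sym/aco.
- by left; exact: aco.
Qed.

Lemma covering_antichain_cut c :
  antichain c -> (forall x, exists2 e, c e & li x e) -> is_cut c.
Proof.
move=> anc cov; split=> // C anC cC; apply/seteqP; split=> // x Cx.
by have [e ce xe] := cov x; have [/(_ xe)|->] := anC x e Cx (cC e ce).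
Qed.

Lemma line_meets_bigcup (hN : causal_net N) (hK : K_dense N) l
    (T : Type) (I : set T) (A : T -> set (node N)) :
  is_line l -> (forall i, I i -> closed_set (A i)) ->
  (forall i j, I i -> I j -> i <> j -> A i `<=` perp (A j)) ->
  perp (perp (\bigcup_(i in I) A i)) `&` l !=set0 ->
  exists2 i, I i & A i `&` l !=set0.
Proof.
move=> hl clA orA [x [Ux lx]]; set U := \bigcup_(i in I) A i in Ux *.
have [c c_max] := choice (fun i => maximal_antichain (A i)).
have [d [dU and_ maxd]] := maximal_antichain (perp U).
have perpd : perp d = perp (perp U).
  by apply: perp_maximal => //; exact: closed_perp.
have cU i y : I i -> c i y -> U y.
  by move=> Ii ciy; exists i => //; have [cA _ _] := c_max i; exact: cA.
pose k := (\bigcup_(i in I) c i) `|` d.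
have /hK/(_ hl)[y [[[i Ii ciy]|dy] ly]] : is_cut k.
  apply: covering_antichain_cut.
  - move=> y z [[i Ii ciy]|dy] [[j Ij cjz]|dz].
    + have [ij|ij] := pselect (i = j).
        by rewrite -ij in cjz; have [_ anc _] := c_max i; exact: anc.
      have [ciA _ _] := c_max i; have [cjA _ _] := c_max j.
      by left; apply: (orA i j) => //; [exact: ciA|exact: cjA].
    + by left; apply/co_sym; apply: (dU z dz); exact: cU ciy.
    + by left; apply: (dU y dy); exact: cU cjz.
    + exact: and_.
  (* A node concurrent with all of [k] lies in every [perp (A i)], hence in [perp U], and also in
     [perp d], which is [perp (perp U)]; it would be concurrent with itself. *)
  - move=> y; apply: contrapT => ny.
    have yk e : k e -> co y e by move=> ke ye; apply: ny; exists e.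
    have Uy : perp U y.
      move=> a [i Ii]; have [cA _ maxc] := c_max i.
      suff : perp (A i) y by exact.
      rewrite -(perp_maximal hN (clA i Ii) cA maxc) => e ce.
      by apply: yk; left; exists i.
    have : perp (perp U) y by rewrite -perpd => e de; apply: yk; right.
    by move=> /(_ _ Uy); apply; exact: li_refl.
- exists i => //; exists y; split=> //.
  by have [cA _ _] := c_max i; exact: cA.
(* Here [x] is in [perp (perp U)] and [y] in [perp U], yet both are on the line. *)
- by case: (Ux y (dU y dy)); exact: hl.1.
Qed.

(** Needed for the value at [ltop]. A maximal antichain of the whole net is a cut, and the line
    meets it. *)
Lemma line_neq0 (hK : K_dense N) l : is_line l -> l !=set0.
Proof.
move=> hl; have [c [_ anc cov]] := maximal_antichain setT.
have /hK/(_ hl)[x [_ lx]] : is_cut c.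
  by apply: covering_antichain_cut => // x; exact: cov.
by exists x.
Qed.

End Net.

Lemma esum_indicator_uniq (R : realType) (T : choiceType) (I : set T)
    (p : T -> bool) :
  (forall i j, I i -> I j -> p i -> p j -> i = j) ->
  (\esum_(i in I) (p i)%:R%:E = (`[< exists2 i, I i & p i >])%:R%:E :> \bar R)%R.
Proof.
move=> pI; case: asboolP => [[i Ii pi]|np]; last first.
  by apply: esum1 => i Ii; case pi: (p i) => //; case: np; exists i.
(* Splits off the one index that contributes; all other terms vanish. *)
rewrite (esumID [set i]) => [|j _]; last by rewrite lee_fin Num.Theory.ler0n.
rewrite setIidr => [|_ ->//]; rewrite esum_set1 ?pi ?lee_fin//.
rewrite esum1 ?adde0// => j [Ij ji]; case pj: (p j) => //.
by case: ji; exact: pI.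
Qed.

Theorem theorem2 (R : realType) (N : net) (lambda : set (node N)) :
  causal_net N -> locally_finite N -> K_dense N -> is_line lambda ->
  two_valued_state R (line_state lambda).
Proof.
move=> hN _ hK hl; split.
  by apply/asboolP; rewrite /= setTI; exact: line_neq0.
move=> I A orA; rewrite esum_indicator_uniq => [|i j Ii Ij].
  congr ((nat_of_bool _)%:R%:E)%R; apply: asbool_equiv_eq; split.
    move=> /(line_meets_bigcup hN hK hl (fun i _ => closed_valP (A i)) orA).
    by move=> [i Ii Ail]; exists i => //; apply/asboolP.
  move=> [i Ii /asboolP[x [Aix lx]]]; exists x; split=> //.
  exact: (ljoin_ub Ii).
move=> /asboolP[x [Aix lx]] /asboolP[y [Ajy ly]]; apply: contrapT => ij.
by apply: (orA i j Ii Ij ij x Aix y Ajy); exact: hl.1.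
Qed.
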